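(* There is an absolute constant $C>0$ such that the following holds. Let $d\ge 1$ and $\psi\ge 20$ be integers, let $\rho\in(0,1)$, and set $N=\psi\sqrt{\tfrac{\psi}{2}\ln\tfrac{2}{\rho}}$ (assumed to be an integer). Let $a,b\in\{0,1\}^d$ be binary vectors with $|a|\le\psi$ and $|b|\le\psi$, and let $a_s,b_s\in\{0,1\}^N$ be their BinSketch sketches, built with one common uniformly random map $\pi:\{1,\dots,d\}\to\{1,\dots,N\}$. Let $n_{a,b}$ be the estimate of the inner product computed from $a_s$ and $b_s$ alone by the estimation algorithm (defined in the context). Then, with probability at least $1-\rho$ over the choice of $\pi$, $$\big|\langle a,b\rangle-n_{a,b}\big|\le C\sqrt{\psi\ln\tfrac{6}{\rho}}.$$
   Context: For a binary vector $u$, $|u|$ denotes the number of coordinates equal to $1$, and $\langle u,v\rangle=\sum_i u[i]v[i]$ is the inner product. BinSketch: let $\pi$ be a uniformly random map from $\{1,\dots,d\}$ to $\{1,\dots,N\}$ (all $N^d$ maps equally likely). The sketch of $a\in\{0,1\}^d$ is $a_s\in\{0,1\}^N$ with $a_s[j]=\bigvee_{i:\pi(i)=j}a[i]$ (bitwise OR, equal to $0$ if no $i$ is mapped to $j$). The same $\pi$ is used for all vectors. Estimation algorithm: put $n=1-\frac1N$, $n_{a_s}=|a_s|$, $n_{b_s}=|b_s|$, $n_{a_s,b_s}=\langle a_s,b_s\rangle$, $n_a=\ln\!\big(1-\tfrac{n_{a_s}}{N}\big)/\ln n$, $n_b=\ln\!\big(1-\tfrac{n_{b_s}}{N}\big)/\ln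 n$, and output $$n_{a,b}=n_a+n_b-\frac{1}{\ln n}\ln\!\Big(n^{n_a}+n^{n_b}+\frac{n_{a_s,b_s}}{N}-1\Big).$$ The stated inequality is understood to include that the arguments of the logarithms are positive, so that $n_{a,b}$ is defined. *)

(* Defs.v *)
(* MathComp-Analysis, over an arbitrary [R : realType]. *)
From HB Require Import structures.
From mathcomp Require Import all_boot all_order all_algebra.
From mathcomp Require Import all_classical all_reals all_analysis.

Set Implicit Arguments.
Unset Strict Implicit.
Unset Printing Implicit Defensive.

Import Order.TTheory GRing.Theory Num.Theory.
Local Open Scope ring_scope.

Definition bvec (n : nat) := {ffun 'I_n -> bool}.

Definition weight (n : nat) (u : bvec n) : nat := (\sum_(i < n) u i)%N.

Definition inner (n : nat) (u v : bvec n) : nat := (\sum_(i < n) u i * v i)%N.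

Definition sketch (d N : nat) (pi : {ffun 'I_d -> 'I_N}) (a : bvec d) : bvec N :=
  [ffun j => \big[orb/false]_(i < d | pi i == j) a i].

Definition Pr_unif (R : realType) (T : finType) (A : {set T}) : R :=
  #|A|%:R / #|T|%:R.

Section Estimate.
Variables (R : realType) (N : nat).
Implicit Types u v : bvec N.

Definition nbase : R := 1 - N%:R^-1.

Definition est_weight_arg u : R := 1 - (weight u)%:R / N%:R.

Definition est_weight u : R := ln (est_weight_arg u) / ln nbase.

Definition est_inner_arg u v : R :=
  nbase `^ est_weight u + nbase `^ est_weight v + (inner u v)%:R / N%:R - 1.

Definition est_inner u v : R :=
  est_weight u + est_weight v - (ln nbase)^-1 * ln (est_inner_arg u v).

(* [ln] is total in the library (0 on nonpositive reals), so positivity of the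
   arguments must be required separately for the estimate to be meaningful. *)
Definition est_defined u v : bool :=
  [&& 0 < est_weight_arg u, 0 < est_weight_arg v & 0 < est_inner_arg u v].

End Estimate.

(* Main.v *)
(* Put q = 1 - 1/N and est u = ln (1 - |u_s|/N) / ln q.  Since q^(est u) = 1 - |u_s|/N,
   the estimate is est a + est b - est (a \/ b), while
   <a,b> = |a| + |b| - |a \/ b|, so it suffices to control est u - |u| for the
   three vectors a, b and a \/ b, all of weight at most 2 psi.
   The number of empty bins after throwing k balls has mean N q^k, and is
   subgaussian with variance proxy O(k): averaging out the last ball shows that
   E exp(s * empty) <= exp(s N q^k + 2 s^2 k) for |s| <= 1/2.  Hence outside an
   event of probability rho/3 the deviation is at most t = 4 sqrt(psi ln(6/rho)).
   As N >= 2.2 psi, the arguments of the logarithms stay above 1/11, and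
   |ln q| >= 1/N turns a deviation t of the bin count into an error at most
   11 t of est; the three errors add up to C = 132. *)
Require Import Defs.
From HB Require Import structures.
From mathcomp Require Import all_boot all_order all_algebra.
From mathcomp Require Import all_classical all_reals all_analysis.
From mathcomp Require Import ring lra.

Set Implicit Arguments.
Unset Strict Implicit.
Unset Printing Implicit Defensive.

Import Order.TTheory GRing.Theory Num.Theory.
Local Open Scope ring_scope.

(** * Elementary inequalities for powers, exponentials and logarithms *)

Lemma bernoulli_le (R : realDomainType) (x : R) (k : nat) :
  0 <= x <= 1 -> 1 - k%:R * x <= (1 - x) ^+ k.
Proof.
move=> /andP[x0 x1]; elim: k => [|k IH]; first by rewrite mul0r subr0 expr0.
rewrite exprS (le_trans _ (ler_wpM2l _ IH)) ?subr_ge0// -natr1.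
have : 0 <= k%:R * (x * x) by rewrite mulr_ge0// mulr_ge0.
by lra.
Qed.

Section ExpLn.
Variable R : realType.
Implicit Types x y c : R.

(** Inverting [exp (-x) >= 1 - x] gives [exp x <= 1 / (1 - x)], and [(1 + x + 2 x^2)(1 - x) = 1 +
    x^2 (1 - 2 x)] is at least 1 when [x <= 1/2]. *)
Lemma expR_le_quadratic x : x <= 2^-1 -> expR x <= 1 + x + 2 * x ^+ 2.
Proof.
move=> xh; rewrite -[expR x]invrK -expRN.
have h : 0 < 1 - x by lra.
rewrite (le_trans (y := (1 - x)^-1))//.
  by rewrite lef_pV2 ?posrE ?expR_gt0// expR_ge1Dx.
rewrite -[_^-1]mul1r ler_pdivrMr//.
have : 0 <= x ^+ 2 * (1 - 2 * x) by rewrite mulr_ge0 ?sqr_ge0//; lra.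
by rewrite !expr2; lra.
Qed.

Lemma ln_sub_le c x y : 0 < c -> c <= x -> c <= y ->
  ln x - ln y <= `|x - y| / c.
Proof.
move=> c0 cx cy; have x0 := lt_le_trans c0 cx; have y0 := lt_le_trans c0 cy.
rewrite -ln_div ?posrE// (_ : x / y = 1 + (x - y) / y); last first.
  by field; rewrite gt_eqF.
have yx : -1 < (x - y) / y by rewrite ltr_pdivlMr//; lra.
rewrite (le_trans (le_ln1Dx yx))// (le_trans (y := `|x - y| / y))//.
  by rewrite ler_wpM2r ?ler_norm// invr_ge0 ltW.
by rewrite ler_wpM2l// lef_pV2.
Qed.

Lemma ln_lipschitz c x y : 0 < c -> c <= x -> c <= y ->
  `|ln x - ln y| <= `|x - y| / c.
Proof.
move=> c0 cx cy; rewrite ler_norml ln_sub_le// andbT lerNl opprB distrC.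
exact: ln_sub_le.
Qed.

Lemma exp_markov (T : finType) (Y : T -> R) (s t : R) : 0 <= s ->
  #|[set w | t <= Y w]%SET|%:R * expR (s * t) <= \sum_w expR (s * Y w).
Proof.
move=> s0; rewrite -sum1_card natr_sum mulr_suml.
under eq_bigr do rewrite mul1r.
rewrite [leRHS](bigID (fun w => w \in [set w | t <= Y w]%SET))/= ler_wpDr//.
  by apply: sumr_ge0 => w _; rewrite expR_ge0.
apply: ler_sum => w; rewrite inE => tY.
by rewrite ler_expR ler_wpM2l.
Qed.

End ExpLn.

(** * Resampling one value of a uniformly random map *)

Section Resampling.
Variables I J : finType.
Implicit Types f : {ffun I -> J}.

Definition resample f i j : {ffun I -> J} :=
  [ffun k => if k == i then j else f k].

(** Redrawing the value at [i] keeps the uniform law, which stands in for conditioning on the other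
    values. Swapping the old value at [i] with the fresh one is an involution on pairs, hence a
    valid reindexing. *)
Lemma sum_resample (V : nmodType) (F : {ffun I -> J} -> V) (i : I) :
  \sum_f \sum_j F (resample f i j) = \sum_f F f *+ #|J|.
Proof.
rewrite pair_bigA /=.
pose h (p : {ffun I -> J} * J) := (resample p.1 i p.2, p.1 i).
have hK : involutive h.
  move=> [f j]; rewrite /h /= ffunE eqxx; congr (_, _).
  by apply/ffunP => k; rewrite !ffunE; case: eqP => [->|].
under [RHS]eq_bigr do rewrite -sumr_const.
rewrite pair_bigA /= [RHS](reindex_inj (inv_inj hK)) /=.
by apply: eq_bigr.
Qed.

Lemma imset_resample f i j (A : {set I}) : i \notin A ->
  (resample f i j @: (i |: A) = j |: f @: A)%SET.
Proof.
move=> iA; rewrite imsetU1 ffunE eqxx; congr (_ |: _)%SET.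
apply: eq_in_imset => k kA; rewrite ffunE; case: eqP => // ki.
by rewrite -ki kA in iA.
Qed.

End Resampling.

(** * Concentration of the number of empty bins *)

Section MissedBins.
Variables (R : realType) (I J : finType).
Hypothesis J_gt0 : (0 < #|J|)%N.
Local Notation q := (1 - #|J|%:R^-1 : R).
Local Notation missed f A := #|(~: (f @: A))%SET|.
Implicit Types (A : {set I}) (B : {set J}).

Let M_gt0 : 0 < #|J|%:R :> R. Proof. by rewrite ltr0n. Qed.

Lemma card_setC_R B : #|(~: B)%SET|%:R = #|J|%:R - #|B|%:R :> R.
Proof. by rewrite -(cardsC B) natrD addrC addKr. Qed.

(** With [m] empty bins, one throw removes [z j], an indicator of mean [p = m / M]. As
    [q * m = m - p], the exponent is [s * q * m] plus the centred term [s * (p - z j)]; the linear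
    part of the quadratic bound sums to zero, and [1 + 2 s^2 <= exp (2 s^2)]. *)
Lemma sum_expR_new_bin B (s : R) : `|s| <= 2^-1 ->
  \sum_(j : J) expR (s * #|(~: (j |: B))%SET|%:R) <=
  #|J|%:R * expR (2 * s ^+ 2) * expR (s * q * #|(~: B)%SET|%:R).
Proof.
move=> sh; set m : R := #|(~: B)%SET|%:R; set M : R := #|J|%:R.
have M0 : M != 0 by rewrite gt_eqF.
pose p := m / M.
have p01 : 0 <= p <= 1.
  rewrite divr_ge0 ?ler0n//= ler_pdivrMr// mul1r ler_nat.
  exact: max_card.
pose z (j : J) : R := (j \in (~: B)%SET)%:R.
have zb j : `|s * (p - z j)| <= `|s|.
  rewrite normrM ler_piMr// /z; case: (_ \in _); rewrite ler_norml/=; lra.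
have step j : expR (s * #|(~: (j |: B))%SET|%:R) <=
    expR (s * q * m) * (1 + s * (p - z j) + 2 * s ^+ 2).
  have -> : s * #|(~: (j |: B))%SET|%:R = s * q * m + s * (p - z j).
    have em : m = M - #|B|%:R by rewrite /m card_setC_R.
    rewrite card_setC_R -/M cardsU1 natrD /z inE /p em.
    by field.
  rewrite expRD ler_wpM2l ?expR_ge0// (le_trans (expR_le_quadratic _))//.
    by rewrite (le_trans (ler_norm _))// (le_trans (zb j)).
  rewrite lerD2l ler_pM2l// -(real_normK (num_real (s * _))).
  by rewrite -(real_normK (num_real s)) lerXn2r// nnegrE.
rewrite (le_trans (ler_sum _ (fun j _ => step j)))//.
rewrite -mulr_sumr mulrC ler_wpM2r ?expR_ge0// !big_split/= -mulr_sumr sumrB.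
rewrite !sumr_const -natr_sum -[X in X%:R]big_mkcond/=.
rewrite sum1_card (_ : #|xpredT| = #|J|); last exact: eq_card.
rewrite -(mulr_natr p) divfK// subrr mulr0 addr0 -[X in _ + X]mulr_natr -/M.
rewrite (_ : M + _ = M * (1 + 2 * s ^+ 2)); last by ring.
by rewrite ler_pM2l ?expR_ge1Dx.
Qed.

Let q01 : 0 <= q <= 1.
Proof.
by rewrite subr_ge0 invf_le1// ler1n J_gt0 gerBl invr_ge0 ler0n.
Qed.

(* The last ball thrown is averaged out first: given the others it multiplies
   the expected number of missed bins by [q], so the induction proceeds with
   the smaller parameter [s * q]. *)
Lemma mgf_missed (A : {set I}) (s : R) : `|s| <= 2^-1 ->
  \sum_(f : {ffun I -> J}) expR (s * (missed f A)%:R) <=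
  #|{ffun I -> J}|%:R *
    expR (s * (#|J|%:R * q ^+ #|A|) + 2 * s ^+ 2 * #|A|%:R).
Proof.
move: {2}#|A| (erefl #|A|) => k; elim: k A s => [|k IH] A s.
  move=> /eqP; rewrite cards_eq0 => /eqP -> _.
  rewrite cards0 expr0 !mulr0 mulr1 addr0.
  under eq_bigr do rewrite imset0 finset.setC0 cardsT.
  by rewrite sumr_const mulr_natl.
move=> Ak sh; have /card_gt0P[i iA] : (0 < #|A|)%N by rewrite Ak.
pose B := (A :\ i)%SET.
have iB : i \notin B by rewrite !inE eqxx.
have AE : A = (i |: B)%SET by rewrite finset.setD1K.
have Bk : #|B| = k by move: Ak; rewrite AE cardsU1 iB add1n => -[].
have sqh : `|s * q| <= 2^-1.
  case/andP: q01 => q0 q1.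
  by rewrite (le_trans _ sh)// normrM (ger0_norm q0) ler_piMr.
(* The factor [#|J|] pays for the extra sum over the fresh position of ball [i]. *)
rewrite -(@ler_pM2l _ #|J|%:R)// mulr_natl -sumrMnl.
have /= <- :=
  sum_resample (fun f : {ffun I -> J} => expR (s * (missed f A)%:R)) i.
have step (f : {ffun I -> J}) : \sum_j expR (s * (missed (resample f i j) A)%:R) <=
    #|J|%:R * expR (2 * s ^+ 2) * expR (s * q * (missed f B)%:R).
  rewrite (eq_bigr (fun j => expR (s * #|(~: (j |: f @: B))%SET|%:R))); last first.
    by move=> j _; rewrite AE imset_resample.
  exact: sum_expR_new_bin.
rewrite (le_trans (ler_sum _ (fun f _ => step f)))// -mulr_sumr -[leLHS]mulrA.
rewrite ler_pM2l// (le_trans (ler_wpM2l (expR_ge0 _) (IH B _ Bk sqh)))//.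
rewrite mulrCA ler_wpM2l// -expRD ler_expR Ak Bk (exprS q) -(natr1 k).
(* The mean terms agree exactly, since [s * q * q^k = s * q^(k+1)]; only the variance terms are
   compared. *)
have : (s * q) ^+ 2 <= s ^+ 2.
  case/andP: q01 => q0 q1.
  by rewrite exprMn ler_piMr ?sqr_ge0// exprn_ile1.
move=> /(ler_wpM2r (ler0n R k)).
by set u := (s * q) ^+ 2; move: (q ^+ k) => Q; lra.
Qed.

Let dev (f : {ffun I -> J}) A : R := (missed f A)%:R - #|J|%:R * q ^+ #|A|.

Lemma missed_tail (A : {set I}) (s t : R) : 0 <= s <= 2^-1 ->
  #|[set f : {ffun I -> J} | t <= `|dev f A|]%SET|%:R <=
  #|{ffun I -> J}|%:R * (2 * expR (2 * s ^+ 2 * #|A|%:R - s * t)).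
Proof.
move=> /andP[s0 sh].
(* Taking [e] to be 1 and -1 gives the two tails, whence the factor 2. *)
have side e : `|e| = 1 ->
    #|[set f : {ffun I -> J} | t <= e * dev f A]%SET|%:R <=
    #|{ffun I -> J}|%:R * expR (2 * s ^+ 2 * #|A|%:R - s * t).
  move=> e1; rewrite -(ler_pM2r (expR_gt0 (s * t))).
  rewrite (le_trans (exp_markov _ _ s0))//.
  rewrite -[leRHS]mulrA -expRD subrK.
  have eh : `|s * e| <= 2^-1 by rewrite normrM e1 mulr1 ger0_norm.
  (* This factor undoes the centring in [dev], so that [mgf_missed] applies with parameter
     [s * e]. *)
  rewrite -(ler_pM2r (expR_gt0 (s * e * (#|J|%:R * q ^+ #|A|)))) mulr_suml.
  rewrite -[leRHS]mulrA -expRD.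
  under eq_bigr do rewrite -expRD [s * (e * _)]mulrA -mulrDr subrK.
  rewrite (le_trans (mgf_missed A eh))// exprMn -[e ^+ 2]real_normK ?num_real//.
  by rewrite e1 expr1n mulr1 addrC.
have h1 := side 1 (normr1 _); have h2 := side (-1) (normrN1 _).
have := lerD h1 h2; rewrite -natrD -mulrDr -mulr2n -[_ *+ 2]mulr_natl.
apply: le_trans; rewrite ler_nat.
rewrite (leq_trans _ (leq_card_setU _ _))// subset_leq_card//.
by apply/fintype.subsetP => f; rewrite !inE mul1r mulN1r lter_normr.
Qed.

Lemma occupied_tail (A : {set I}) (K t : R) : 0 < K -> #|A|%:R <= K -> 0 < t ->
  #|[set f : {ffun I -> J} |
      t < `|#|(f @: A)%SET|%:R - #|J|%:R * (1 - q ^+ #|A|)|]%SET|%:R <=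
  #|{ffun I -> J}|%:R * (2 * expR (- (t ^+ 2 / (8 * K)))).
Proof.
move=> K0 AK t0.
have devE (f : {ffun I -> J}) :
    `|#|(f @: A)%SET|%:R - #|J|%:R * (1 - q ^+ #|A|)| = `|dev f A|.
  by rewrite -normrN /dev card_setC_R; congr (`|_|); lra.
have [tK|Kt] := leP t (2 * K).
  (* This minimises [2 s^2 K - s t], with value [- t^2 / (8 K)]; the case hypothesis is exactly
     [s <= 1/2]. *)
  pose s := t / (4 * K).
  have sh : 0 <= s <= 2^-1.
    have K4 : 0 < 4 * K by rewrite mulr_gt0.
    by rewrite /s divr_ge0 ?(ltW t0) ?(ltW K4)//= ler_pdivrMr//; lra.
  apply: le_trans (le_trans (missed_tail A t sh) _).
    rewrite ler_nat subset_leq_card//; apply/fintype.subsetP => f.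
    by rewrite !inE devE => /ltW.
  rewrite !ler_wpM2l// ler_expR.
  have : 2 * s ^+ 2 * #|A|%:R <= 2 * s ^+ 2 * K.
    by rewrite ler_wpM2l// mulr_ge0// sqr_ge0.
  move=> /le_trans; rewrite -lerBrDr; apply; rewrite le_eqVlt; apply/orP; left.
  by apply/eqP; rewrite /s; field; rewrite gt_eqF.
(* For [t > 2 K] the event is empty: the number of occupied bins and, by Bernoulli, its mean both
   lie between 0 and [#|A| <= K]. *)
rewrite (_ : [set f | _]%SET = finset.set0); last first.
  apply/setP => f; rewrite !inE; apply/negbTE; rewrite -leNgt.
  case/andP: q01 => q0 q1.
  have Mi : 0 <= (#|J|%:R^-1 : R) <= (1 : R) by move: q0 q1; lra.
  have h1 := bernoulli_le #|A| Mi.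
  have h2 : q ^+ #|A| <= 1 by rewrite exprn_ile1.
  have h3 : #|(f @: A)%SET|%:R <= #|A|%:R :> R by rewrite ler_nat leq_imset_card.
  have h4 : 0 <= #|(f @: A)%SET|%:R :> R by [].
  have h5 : #|J|%:R * (1 - q ^+ #|A|) <= #|A|%:R.
    by rewrite mulrC -ler_pdivlMr//; move: h1; lra.
  have h6 : 0 <= #|J|%:R * (1 - q ^+ #|A|) by rewrite mulr_ge0// subr_ge0.
  by rewrite ler_norml; apply/andP; split; lra.
by rewrite cards0 !mulr_ge0// expR_ge0.
Qed.

End MissedBins.

(** * The estimate as a combination of three weight estimates *)

Definition bor (n : nat) (x y : bvec n) : bvec n := [ffun j => x j || y j].

Lemma weight_bor (n : nat) (x y : bvec n) :
  (weight (bor x y) + inner x y = weight x + weight y)%N.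
Proof.
rewrite /weight /inner -!big_split; apply: eq_bigr => j _.
by rewrite ffunE; case: (x j); case: (y j).
Qed.

Section Estimator.
Variables (R : realType) (N : nat).
Hypothesis N_gt1 : (1 < N)%N.
Implicit Types u v : bvec N.
Local Notation q := (nbase R N).

Let N_gt0 : 0 < N%:R :> R. Proof. by rewrite ltr0n ltnW. Qed.

Let N_neq0 : N%:R != 0 :> R. Proof. by rewrite gt_eqF. Qed.

Lemma nbase_gt0 : 0 < q.
Proof. by rewrite subr_gt0 invf_lt1// ltr1n. Qed.

Lemma ln_nbase_le : ln q <= - N%:R^-1.
Proof. by rewrite le_ln1Dx// ltrN2 invf_lt1// ltr1n. Qed.

Lemma ln_nbase_lt0 : ln q < 0.
Proof. by rewrite (le_lt_trans ln_nbase_le)// oppr_lt0 invr_gt0. Qed.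

(** The error is a difference of logarithms divided by [ln q]. On [[c, +oo)] the logarithm is
    [1/c]-Lipschitz, and the factor [1 / |ln q| <= N] cancels the division of the bin count by [N].
    Bernoulli gives [c <= q^k]. *)
Lemma est_weight_error u (k : nat) (c t : R) :
  0 < c -> c <= est_weight_arg R u -> c <= 1 - k%:R / N%:R ->
  `|(weight u)%:R - N%:R * (1 - q ^+ k)| <= t ->
  `|est_weight R u - k%:R| <= t / c.
Proof.
move=> c0 cu ck ut; set L := ln q.
have L0 : L != 0 by rewrite lt_eqF// ln_nbase_lt0.
have NL : `|L|^-1 <= N%:R.
  rewrite -[leRHS]invrK lef_pV2 ?posrE ?normr_gt0 ?invr_gt0//.
  by rewrite ltr0_norm ?ln_nbase_lt0// lerNr ln_nbase_le.
have cq : c <= q ^+ k.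
  by rewrite (le_trans ck)// bernoulli_le// invr_ge0 ler0n invf_le1// ler1n ltnW.
have -> : est_weight R u - k%:R = (ln (est_weight_arg R u) - ln (q ^+ k)) / L.
  rewrite lnXn ?nbase_gt0// mulrBl; congr (_ - _).
  by rewrite -[ln q *+ k]mulr_natl mulfK.
have -> : t / c = (t / N%:R / c) * N%:R by field; rewrite N_neq0 gt_eqF.
rewrite normrM normfV ler_pM ?invr_ge0//.
rewrite (le_trans (ln_lipschitz c0 cu cq))// ler_pM2r ?invr_gt0//.
rewrite ler_pdivlMr// -[X in _ * X]gtr0_norm// -normrM -normrN.
rewrite (_ : - _ = (weight u)%:R - N%:R * (1 - q ^+ k))//.
by rewrite /est_weight_arg; field.
Qed.

Lemma powR_est_weight u : 0 < est_weight_arg R u ->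
  q `^ est_weight R u = est_weight_arg R u.
Proof.
move=> u0; apply: ln_inj; rewrite ?posrE ?powR_gt0 ?nbase_gt0//.
by rewrite ln_powR divfK// lt_eqF// ln_nbase_lt0.
Qed.

(** By inclusion-exclusion on the sketches, the last logarithm has as its argument the fraction of
    zeros in their union. *)
Lemma est_inner_argE u v :
  0 < est_weight_arg R u -> 0 < est_weight_arg R v ->
  est_inner_arg R u v = est_weight_arg R (bor u v).
Proof.
move=> u0 v0; rewrite /est_inner_arg !powR_est_weight// /est_weight_arg.
have /(congr1 (fun n => n%:R : R)) := weight_bor u v.
rewrite !natrD => h; rewrite -[(weight (bor _ _))%:R](addrK (inner u v)%:R).
by rewrite h; field.
Qed.

Lemma est_innerE u v :
  0 < est_weight_arg R u -> 0 < est_weight_arg R v ->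
  est_inner R u v = est_weight R u + est_weight R v - est_weight R (bor u v).
Proof. by move=> u0 v0; rewrite /est_inner est_inner_argE// mulrC. Qed.

End Estimator.

(** * Sketches as images of supports *)

Section Sketch.
Variables d N : nat.
Implicit Types (pi : {ffun 'I_d -> 'I_N}) (a b : bvec d).

Definition supp (n : nat) (u : bvec n) : {set 'I_n} := [set i | u i]%SET.

Lemma weight_supp (n : nat) (u : bvec n) : weight u = #|supp u|.
Proof.
rewrite /weight -sum1_card [RHS]big_mkcond/=.
by apply: eq_bigr => i _; rewrite inE; case: (u i).
Qed.

(** This identifies the weight of a sketch with the number of bins occupied by the balls in
    [supp a]. *)
Lemma supp_sketch pi a : supp (sketch pi a) = (pi @: supp a)%SET.
Proof.
apply/setP => j; rewrite inE ffunE big_orE; apply/existsP/imsetP.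
  by move=> [i /andP[/eqP <- ai]]; exists i; rewrite ?inE.
by move=> [i]; rewrite inE => ai ->; exists i; rewrite eqxx.
Qed.

(** Thanks to this, the union of the two sketches is itself a sketch made with the same [pi], and
    the tail bound applies to it. *)
Lemma sketch_bor pi a b : sketch pi (bor a b) = bor (sketch pi a) (sketch pi b).
Proof.
apply/ffunP => j; rewrite !ffunE -big_split/=.
by apply: eq_bigr => i _; rewrite ffunE.
Qed.

End Sketch.

Lemma sketch_tail (R : realType) (d N : nat) (a : bvec d) (K t : R) :
  (0 < N)%N -> 0 < K -> (weight a)%:R <= K -> 0 < t ->
  #|[set pi : {ffun 'I_d -> 'I_N} |
      t < `|(weight (sketch pi a))%:R - N%:R * (1 - nbase R N ^+ weight a)|]%SET|%:R
  <= #|{ffun 'I_d -> 'I_N}|%:R * (2 * expR (- (t ^+ 2 / (8 * K)))).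
Proof.
rewrite weight_supp => N0 K0 aK t0.
have := @occupied_tail R 'I_d 'I_N _ (supp a) K t K0 aK t0.
rewrite card_ord => /(_ N0); congr (_%:R <= _).
by apply: eq_card => pi; rewrite !inE weight_supp supp_sketch.
Qed.

Lemma weight_sketch_le (d N : nat) (pi : {ffun 'I_d -> 'I_N}) (a : bvec d) :
  (weight (sketch pi a) <= weight a)%N.
Proof. by rewrite !weight_supp supp_sketch leq_imset_card. Qed.

(** * Numerical bounds and the union bound *)

Lemma bins_ge (R : realType) (psi : nat) (rho : R) : (20 <= psi)%N -> 0 < rho < 1 ->
  11 / 5 * psi%:R <= psi%:R * Num.sqrt (psi%:R / 2 * ln (2 / rho)).
Proof.
move=> psi20 /andP[rho0 rho1].
have psi20R : 20 <= psi%:R :> R by rewrite (ler_nat _ 20).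
(* [exp (1/2) <= 2] because [exp (-1/2) >= 1 - 1/2]. *)
have ln2 : 2^-1 <= ln (2 / rho).
  rewrite -ler_expR lnK ?posrE ?divr_gt0// (le_trans (y := 2))//; last first.
    by rewrite ler_pdivlMr//; lra.
  rewrite -[X in _ <= X]invrK -[expR _]invrK -expRN lef_pV2 ?posrE ?expR_gt0//.
  by rewrite (le_trans _ (expR_ge1Dx _))//; lra.
rewrite mulrC ler_wpM2l// -[leLHS]ger0_norm// -sqrtr_sqr ler_wsqrtr//.
(* The radicand is at least 5, while [(11/5)^2 = 4.84]. *)
have : 10 * 2^-1 <= psi%:R / 2 * ln (2 / rho) by rewrite ler_pM//; lra.
by lra.
Qed.

Theorem theorem1 (R : realType) :
  exists2 C : R, 0 < C &
    forall (d psi N : nat) (rho : R) (a b : bvec d),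
      (1 <= d)%N -> (20 <= psi)%N -> 0 < rho < 1 ->
      N%:R = psi%:R * Num.sqrt (psi%:R / 2 * ln (2 / rho)) ->
      (weight a <= psi)%N -> (weight b <= psi)%N ->
      1 - rho <=
        Pr_unif R [set pi : {ffun 'I_d -> 'I_N} |
          est_defined R (sketch pi a) (sketch pi b) &&
          (`| (inner a b)%:R - est_inner R (sketch pi a) (sketch pi b) |
             <= C * Num.sqrt (psi%:R * ln (6 / rho)))].
Proof.
exists 132; first by [].
move=> d psi N rho a b d1 psi20 rho01 NE aP bP.
have NP : 11 / 5 * psi%:R <= N%:R :> R by rewrite NE bins_ge.
have psi20R : 20 <= psi%:R :> R by rewrite (ler_nat _ 20).
have N1 : (1 < N)%N by rewrite -(ltr_nat R); lra.
have N0 : 0 < N%:R :> R by lra.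
case/andP: rho01 => rho0 rho1.
pose L : R := ln (6 / rho).
have L0 : 0 < L by rewrite ln_gt0// ltr_pdivlMr//; lra.
have PL0 : 0 < psi%:R * L by rewrite mulr_gt0//; lra.
pose t := 4 * Num.sqrt (psi%:R * L).
have t0 : 0 < t by rewrite mulr_gt0// sqrtr_gt0.
pose c := bor a b.
have cP : (weight c <= psi + psi)%N.
  by rewrite (leq_trans _ (leq_add aP bP))// -weight_bor leq_addr.
pose bad (u : bvec d) := [set pi : {ffun 'I_d -> 'I_N} |
  t < `|(weight (sketch pi u))%:R - N%:R * (1 - nbase R N ^+ weight u)|]%SET.
pose F : R := #|{ffun 'I_d -> 'I_N}|%:R.
have F0 : 0 < F by rewrite ltr0n card_ffun !card_ord expn_gt0 (ltnW N1).
(* With [K = 2 psi] and [t^2 = 16 psi L], the exponent [t^2 / (8 K)] equals [L], and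
   [2 exp (-L) = 2 rho / 6]. *)
have badP u : (weight u <= psi + psi)%N -> #|bad u|%:R <= F * (rho / 3).
  rewrite -(ler_nat R) natrD -mulr2n -[_ *+ 2]mulr_natl => uP.
  apply: le_trans (sketch_tail _ _ uP t0) _; rewrite ?(ltnW N1) ?mulr_gt0//; first by lra.
  rewrite ler_wpM2l ?ler0n// (_ : t ^+ 2 / _ = L).
    rewrite expRN lnK ?posrE ?divr_gt0// invf_div.
    by rewrite le_eqVlt; apply/orP; left; apply/eqP; field.
  rewrite exprMn sqr_sqrtr ?(ltW PL0)//; field; lra.
have errP pi u : (weight u <= psi + psi)%N -> pi \notin bad u ->
    (11^-1 <= est_weight_arg R (sketch pi u)) &&
    (`|est_weight R (sketch pi u) - (weight u)%:R| <= 11 * t).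
  move=> uP; rewrite inE -leNgt => ut.
  (* [k <= 2 psi] and [N >= 11/5 psi] give [k / N <= 10/11]. This serves both the true weight and
     the sketch weight, which is no larger. *)
  have boundP k : (k <= psi + psi)%N -> 11^-1 <= 1 - k%:R / N%:R :> R.
    rewrite -(ler_nat R) natrD => kP; rewrite lerBrDr -lerBrDl ler_pdivrMr//.
    by lra.
  have h := boundP _ (leq_trans (weight_sketch_le pi u) uP).
  rewrite {1}/est_weight_arg h/= mulrC -[11 in leRHS]invrK.
  exact: est_weight_error (boundP _ uP) ut.
set good := [set pi | _]%SET.
(* Outside the three bad events everything is deterministic, including the positivity of the three
   logarithm arguments. *)
have sub : (~: (bad a :|: bad b :|: bad c) \subset good)%SET.
  apply/fintype.subsetP => pi; rewrite !inE !negb_or -!andbA.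
  case/and3P => na nb nc.
  have [aP' bP'] : (weight a <= psi + psi)%N /\ (weight b <= psi + psi)%N.
    by split; rewrite (leq_trans _ (leq_addr _ _)).
  have := errP pi a aP'; rewrite inE => /(_ na) /andP[a1 a2].
  have := errP pi b bP'; rewrite inE => /(_ nb) /andP[b1 b2].
  have := errP pi c cP; rewrite inE => /(_ nc) /andP[c1 c2].
  have i11 : 0 < 11^-1 :> R by [].
  have a0 := lt_le_trans i11 a1; have b0 := lt_le_trans i11 b1.
  have c0 := lt_le_trans i11 c1.
  move: c0 c2; rewrite sketch_bor => c0 c2.
  rewrite /est_defined a0 b0 est_inner_argE// c0/= est_innerE//.
  have /(congr1 (fun n => n%:R : R)) := weight_bor a b; rewrite !natrD -/c => abc.
  move: a2 b2 c2; rewrite /t -/L !ler_norml.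
  by move=> /andP[? ?] /andP[? ?] /andP[? ?]; apply/andP; split; lra.
rewrite /Pr_unif ler_pdivlMr// -/F.
have : (#|{ffun 'I_d -> 'I_N}| <= #|good| + (#|bad a| + #|bad b| + #|bad c|))%N.
  rewrite -(cardsC (bad a :|: bad b :|: bad c)%SET) addnC leq_add ?subset_leq_card//.
  by rewrite (leq_trans (leq_card_setU _ _))// leq_add2r leq_card_setU.
rewrite -(ler_nat R) !natrD -/F.
have := badP a (leq_trans aP (leq_addr _ _)).
have := badP b (leq_trans bP (leq_addr _ _)).
have := badP c cP.
by lra.
Qed.
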